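(* Let $n\ge k\ge 2$ be integers and let $P=(n_1,\dots,n_k)$ be a partition of $n$ into $k$ parts with $n/2\ge n_1\ge\dots\ge n_k$. Then there exists a $k$-partite graph $F=(V_1\sqcup\dots\sqcup V_k,E)$ with $|V_i|=n_i$ for all $i\in[k]$ such that $$\delta(V_i)\ \ge\ \Phi(|V_1|,|V_2|,\dots,|V_k|)-|V_i|-1\quad\text{for all } i\in[k],$$ yet $F$ has no Hamiltonian cycle.
   Context: Graphs are finite and simple. $F=(V_1\sqcup\dots\sqcup V_k,E)$ denotes a $k$-partite graph: its vertex set is the disjoint union of nonempty parts $V_1,\dots,V_k$ and every edge joins vertices in different parts. For $S\subseteq V(F)$, $\delta(S)=\min\{d(v):v\in S\}$, where $d(v)$ is the degree of $v$ in $F$. $[m]=\{1,\dots,m\}$. A partition of $n$ into $k$ parts is a non-increasing list $P=(n_1,\dots,n_k)$ of positive integers with $\sum_{i=1}^k n_i=n$. For such $P$ define: - $\lambda=\lambda(P)$: the smallest positive integer $\lambda$ such that $\sum_{i=1}^{\lambda}n_i\ge \left\lceil\frac{n+1}{2}\right\rceil$; - $\mu=\mu(P)$: the smallest positive integer $\mu$ such that $\sum_{i=1}^{\mu}n_i\ge\left\lfloor\frac{n+1}{2}-\frac{n_\mu}{2}\right\rfloor+1$; - $f_i(P)=n_i+\sum_{j=1}^i n_j$ for $i\in[\mu-1]$, and $f(P)=\max_{i\in[\mu-1]}f_i(P)$ (if $\mu=1$ this is a maximum over the empty set, and $f$ is omitted from the maximum defining $\Phi$); - $g(P)=\left\lceil\frac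 n2+\frac{n_\mu}{2}\right\rceil$; - $h_1(P)=\left\lceil\frac n2\right\rceil+n_\lambda$, $h_2(P)=\left\lceil\frac n2\right\rceil+\left\lfloor\frac1\lambda\left\lceil\frac{n+1}{2}\right\rceil\right\rfloor$, $h(P)=\min\{h_1(P),h_2(P)\}$; - $\Phi(P)=\max\{f(P),g(P),h(P)\}$. *)

(* Defs.v *)
From mathcomp Require Import all_boot.

Set Implicit Arguments.
Unset Strict Implicit.
Unset Printing Implicit Defensive.

Definition is_partition (n : nat) (P : seq nat) : bool :=
  [&& all (ltn 0) P, sorted geq P & sumn P == n].

(* Indices into a partition are 1-based, as in n_1, ..., n_k. *)
Definition npart (P : seq nat) (i : nat) : nat := nth 0 P i.-1.

Definition psum (P : seq nat) (i : nat) : nat := \sum_(1 <= j < i.+1) npart P j.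

(* The smallest positive integer i <= b such that p i; b.+1 if there is none. *)
Definition least_pos (p : pred nat) (b : nat) : nat := (find p (iota 1 b)).+1.

(* uphalf m = ceil(m / 2) and m./2 = floor(m / 2). *)
Definition lambda (P : seq nat) : nat :=
  let n := sumn P in
  least_pos (fun l => uphalf n.+1 <= psum P l) (size P).

(* The subtraction is exact, since n_m <= n. *)
Definition mu (P : seq nat) : nat :=
  let n := sumn P in
  least_pos (fun m => (n.+1 - npart P m)./2.+1 <= psum P m) (size P).

Definition f_ (P : seq nat) (i : nat) : nat := npart P i + psum P i.

(* If mu P = 1 this is 0, which does not affect the maximum in Phi. *)
Definition f (P : seq nat) : nat := \max_(1 <= i < mu P) f_ P i.

Definition g (P : seq nat) : nat := uphalf (sumn P + npart P (mu P)).

Definition h1 (P : seq nat) : nat := uphalf (sumn P) + npart P (lambda P).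

Definition h2 (P : seq nat) : nat :=
  uphalf (sumn P) + uphalf (sumn P).+1 %/ lambda P.

Definition h (P : seq nat) : nat := minn (h1 P) (h2 P).

Definition Phi (P : seq nat) : nat := maxn (f P) (maxn (g P) (h P)).

Record sgraph := SGraph {
  vertex :> finType;
  adj : rel vertex;
  adj_sym : symmetric adj;
  adj_irrefl : irreflexive adj }.

Definition degree (F : sgraph) (v : F) : nat := #|[set w | adj v w]|.

(* The neutral element #|F| exceeds every degree, so for nonempty S this is
   the minimum degree over S. *)
Definition delta (F : sgraph) (S : {set F}) : nat :=
  \big[minn/#|F|]_(v in S) degree v.

Definition kpartite (k : nat) (F : sgraph) (V : 'I_k -> {set F}) : Prop :=
  [/\ forall i, V i != set0,
      forall i j, i != j -> [disjoint V i & V j],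
      \bigcup_i V i = [set: F]
    & forall i u v, u \in V i -> v \in V i -> ~~ adj u v].

Definition hamiltonian (F : sgraph) : Prop :=
  exists c : seq F,
    [/\ 2 < size c, uniq c, cycle (@adj F) c & forall v : F, v \in c].

Lemma least_posP (p : pred nat) (b i : nat) :
    0 < i <= b -> p i ->
  [/\ 0 < least_pos p b <= b, p (least_pos p b)
    & forall j, 0 < j -> p j -> least_pos p b <= j].
Proof.
move=> /andP[i0 ib] pi; rewrite /least_pos.
have hp : has p (iota 1 b).
  by apply/hasP; exists i => //; rewrite mem_iota i0 add1n ltnS.
have lt_b : find p (iota 1 b) < b by move: hp; rewrite has_find size_iota.
split=> //; first by have := nth_find 0 hp; rewrite nth_iota.
move=> [|j] // _ pj; rewrite ltnS leqNgt; apply/negP => lt_j.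
by have := before_find 0 lt_j; rewrite nth_iota ?add1n ?pj // (ltn_trans lt_j).
Qed.

Lemma psum_size (P : seq nat) : psum P (size P) = sumn P.
Proof. by rewrite /psum big_add1 sumnE [RHS](big_nth 0). Qed.

Lemma lambdaP (n : nat) (P : seq nat) : 2 <= n -> is_partition n P ->
  [/\ 0 < lambda P <= size P, uphalf n.+1 <= psum P (lambda P)
    & forall l, 0 < l -> uphalf n.+1 <= psum P l -> lambda P <= l].
Proof.
move=> n2 /and3P[_ _ /eqP nE]; rewrite /lambda nE.
apply: (@least_posP (fun l => uphalf n.+1 <= psum P l) _ (size P)).
  by rewrite leqnn andbT; case: (P) nE n2 => // <-.
rewrite psum_size nE leq_uphalf_double -addnn.
by rewrite -[X in X < _]addn0 ltn_add2l ltnW.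
Qed.

Lemma muP (n : nat) (P : seq nat) : 2 <= n -> is_partition n P ->
  [/\ 0 < mu P <= size P,
      (n.+1 - npart P (mu P))./2.+1 <= psum P (mu P)
    & forall m, 0 < m -> (n.+1 - npart P m)./2.+1 <= psum P m -> mu P <= m].
Proof.
move=> n2 /and3P[pos _ /eqP nE]; rewrite /mu nE.
have P0 : 0 < size P by case: (P) nE n2 => // <-.
apply: (@least_posP (fun m => (n.+1 - npart P m)./2.+1 <= psum P m) _ (size P)).
  by rewrite P0 leqnn.
have nk0 : 0 < npart P (size P) by apply: (all_nthP 0 pos); rewrite ltn_predL.
rewrite psum_size nE ltn_half_double -addnn.
apply: (@leq_ltn_trans n); last by rewrite -[X in X < _]addn0 ltn_add2l ltnW.
by rewrite leq_subLR -add1n leq_add2r.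
Qed.

(* Main.v *)
Require Import Defs.
From mathcomp Require Import all_boot.
From mathcomp Require Import zify.

(* Each of the three terms of Phi is attained by a graph of the same shape. In
   the complete k-partite graph choose disjoint vertex sets A and B with
   |B| < |A|, and delete every edge that meets A but not B. The successor map
   of a Hamiltonian cycle would then embed A into B. Writing s_i = n_1 + ... + n_i:
   - for f_i, A consists of the first i parts and B of s_i - 1 other vertices;
   - for g, A consists of floor((n - n_mu)/2) + 1 vertices of the first mu parts
     and B of |A| - 1 vertices outside these parts;
   - for h, A consists of c = floor(n/2) + 1 vertices of the first lambda parts,
     at least min(n_lambda, floor(c/lambda)) from each, and B = ~: A. *)

Set Implicit Arguments.
Unset Strict Implicit.
Unset Printing Implicit Defensive.

(** * Sets of prescribed size, Hamiltonian cycles and minimum degree *)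

Lemma subset_between_card (T : finType) (A B : {set T}) (c : nat) :
    A \subset B -> #|A| <= c <= #|B| ->
  exists C : {set T}, [/\ A \subset C, C \subset B & #|C| = c].
Proof.
move=> sAB /andP[leAc]; rewrite -(subnKC leAc).
elim: (c - #|A|) => [|d IHd] lecB; first by exists A; rewrite addn0.
have [|C [sAC sCB cC]] := IHd; first by rewrite (leq_trans _ lecB) ?leq_add2l.
have : C \proper B by rewrite properEcard sCB cC -addnS.
case/properP=> _ [x xB xC]; exists (x |: C); split.
- by rewrite (subset_trans sAC) ?subsetUr.
- by rewrite subUset sub1set xB.
- by rewrite cardsU1 xC cC addnS.
Qed.

Lemma not_hamiltonian (F : sgraph) (A B : {set F}) :
    #|B| < #|A| -> (forall u v, u \in A -> adj u v -> v \in B) ->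
  ~ hamiltonian F.
Proof.
move=> ltBA nbrA [c [_ uc cc cT]].
suff : #|A| <= #|B| by rewrite leqNgt ltBA.
rewrite -(card_imset A (can_inj (prev_next uc))).
apply/subset_leq_card/subsetP => _ /imsetP[u uA ->].
by apply: (nbrA u) => //; apply: next_cycle.
Qed.

Lemma leq_delta (F : sgraph) (S : {set F}) (d : nat) :
  d <= #|F| -> (forall v, v \in S -> d <= degree v) -> d <= delta S.
Proof.
(* The bound [d <= #|F|] takes care of the neutral element of the minimum. *)
move=> dF dS; apply: (big_ind (fun x => d <= x)) => // x y dx dy.
by rewrite leq_min dx.
Qed.

(** * The split graph and its degrees *)

Section SplitGraph.

Variables (T : finType) (J : eqType) (part : T -> J) (A B : {set T}).

Definition split_adj : rel T := fun u v =>
  (part u != part v) && [|| u \in B, v \in B | (u \notin A) && (v \notin A)].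

Lemma split_adj_sym : symmetric split_adj.
Proof. by move=> u v; rewrite /split_adj eq_sym orbCA [_ && (v \notin A)]andbC. Qed.

Lemma split_adj_irrefl : irreflexive split_adj.
Proof. by move=> u; rewrite /split_adj eqxx. Qed.

Definition split_graph : sgraph := SGraph split_adj_sym split_adj_irrefl.

Let cls u := [set w | part w == part u].

Lemma degree_split_in_B (u : split_graph) : u \in B -> #|T| <= degree u + #|cls u|.
Proof.
move=> uB; rewrite -(cardsC (cls u)) addnC leq_add2r.
apply/subset_leq_card/subsetP => w; rewrite !inE eq_sym => uw.
by rewrite /= /split_adj uw uB.
Qed.

(** Edges into [B] are never deleted, so each vertex of [B] in another part is a neighbour of
    [u]. *)
Lemma degree_split_in_A (u : split_graph) : #|B| <= degree u + #|B :&: cls u|.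
Proof.
rewrite -(cardsID (cls u) B) addnC leq_add2r.
apply/subset_leq_card/subsetP => w; rewrite !inE eq_sym => /andP[uw wB].
by rewrite /= /split_adj uw wB orbT.
Qed.

Lemma degree_split_notin_A (u : split_graph) :
  u \notin A -> #|T| <= degree u + #|cls u| + #|A|.
Proof.
move=> uA; rewrite -(cardsC (cls u :|: A)) addnC -addnA leq_add //.
  apply/subset_leq_card/subsetP => w.
  rewrite !inE negb_or eq_sym => /andP[uw wA].
  by rewrite /= /split_adj uw uA wA !orbT.
by rewrite cardsU leq_subr.
Qed.

Lemma split_not_hamiltonian :
  [disjoint A & B] -> #|B| < #|A| -> ~ hamiltonian split_graph.
Proof.
move=> dAB ltBA; apply: (@not_hamiltonian split_graph A B) => // u v uA.
by rewrite /= /split_adj uA (disjointFr dAB uA) /= orbF => /andP[].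
Qed.

End SplitGraph.

(** * Vertex counts in a disjoint union of parts *)

Lemma card_sigma_lt (k : nat) (m q : 'I_k -> nat) (p : pred 'I_k) :
    (forall j, p j -> q j <= m j) ->
  #|[set u : {j : 'I_k & 'I_(m j)} | p (tag u) && (tagged u < q (tag u))]|
    = \sum_(j | p j) q j.
Proof.
move=> leqm; rewrite -sum1dep_card.
rewrite -(sig_big_dep p (fun j (x : 'I_(m j)) => x < q j) (fun _ _ => 1)) /=.
apply: eq_bigr => j pj; rewrite -(big_ord_widen _ (fun=> 1) (leqm j pj)).
by rewrite sum1_card card_ord.
Qed.

Lemma card_sigma (k : nat) (m : 'I_k -> nat) (p : pred 'I_k) :
  #|[set u : {j : 'I_k & 'I_(m j)} | p (tag u)]| = \sum_(j | p j) m j.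
Proof.
rewrite -(card_sigma_lt (m := m) (q := m) (p := p)) //; apply: eq_card => u.
by rewrite !inE ltn_ord andbT.
Qed.

Lemma psumE (k : nat) (P : k.-tuple nat) (i : nat) : i <= k ->
  psum P i = \sum_(j < k | j < i) tnth P j.
Proof.
move=> ik; rewrite /psum big_add1 /= /npart big_mkord.
rewrite (big_ord_widen k (nth 0 P) ik).
by apply: eq_bigr => j _; rewrite (tnth_nth 0).
Qed.

(** * Reduction of the degree conditions to inequalities on set sizes *)

Section Realization.

Variables (n k : nat) (P : k.-tuple nat).
Hypotheses (hk : 2 <= k) (hn : k <= n) (hP : is_partition n P).

Let T : finType := {j : 'I_k & 'I_(tnth P j)}.
Let V (j : 'I_k) : {set T} := [set u | tag u == j].

(** The conclusion of the theorem with [Phi] replaced by a free [d], so that each term of the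
    maximum can be treated with its own graph. *)
Definition realizable (d : nat) : Prop :=
  exists (F : sgraph) (W : 'I_k -> {set F}),
    [/\ kpartite W,
        forall i, #|W i| = tnth P i,
        forall i, d - #|W i| - 1 <= delta (W i)
      & ~ hamiltonian F].

Let cardV j : #|V j| = tnth P j.
Proof. by rewrite (card_sigma _ (pred1 j)) big_pred1_eq. Qed.

Let sumP : sumn P = n.
Proof. by case/and3P: hP => _ _ /eqP. Qed.

Let card_initial i : i <= k -> #|[set u : T | tag u < i]| = psum P i.
Proof. by move=> ik; rewrite psumE // -(card_sigma (tnth P) (fun j : 'I_k => j < i)). Qed.

Let cardT : #|T| = n.
Proof.
rewrite -cardsT -sumP -psum_size size_tuple -card_initial //.
by apply: eq_card => u; rewrite !inE ltn_ord.
Qed.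

Let tnth_gt0 j : 0 < tnth P j.
Proof. by case/and3P: hP => /all_tnthP posP _ _; apply: posP. Qed.

Let npart_leq i j : i <= j -> j <= k -> npart P j <= npart P i.
Proof.
case/and3P: hP => _ sP _ ij jk; rewrite /npart.
have [->//|ltij] := eqVneq i.-1 j.-1.
apply: (sorted_ltn_nth _ 0 sP); rewrite ?inE ?size_tuple; try lia.
by move=> y x z /= xy yz; apply: leq_trans yz xy.
Qed.

Let npart_tnth (j : 'I_k) i : j < i -> i <= k -> npart P i <= tnth P j.
Proof.
move=> ji ik; rewrite (tnth_nth 0) -[nth 0 P j]/(npart P j.+1).
exact: npart_leq.
Qed.

Let npart_leq_sum i : npart P i <= n.
Proof.
rewrite -sumP /npart; elim: (val P) i.-1 => [|x s IHs] [|j] //=.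
  exact: leq_addr.
exact: leq_trans (IHs j) (leq_addl _ _).
Qed.

Let psumS i : psum P i.+1 = psum P i + npart P i.+1.
Proof. by rewrite /psum big_nat_recr. Qed.

Lemma realizable_maxn d e : realizable d -> realizable e -> realizable (maxn d e).
Proof. by case: (leqP d e). Qed.

(** The three bounds on [d] serve the vertices of part [j] in [B], in [A] and in neither, whose
    degrees are at least [n - n_j], [#|B| - #|B :&: V j|] and [n - n_j - #|A|] respectively. *)
Lemma realizable_split (A B : {set T}) (d : nat) :
    [disjoint A & B] -> #|B| < #|A| -> d <= n.+1 ->
    (forall j, A :&: V j != set0 -> d + #|B :&: V j| <= #|B| + tnth P j + 1) ->
    (forall u, u \notin A -> u \notin B -> d + #|A| <= n.+1) ->
  realizable d.
Proof.
move=> dAB ltBA dn dA dR; exists (split_graph (fun u : T => tag u) A B), V.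
split=> //; last exact: split_not_hamiltonian.
- split=> [i | i j ij | | i u v].
  + by rewrite -card_gt0 cardV.
  + rewrite -setI_eq0; apply/eqP/setP => u; rewrite !inE.
    by apply: contraNF ij => /andP[/eqP<-].
  + by apply/setP => u; rewrite inE; apply/bigcupP; exists (tag u); rewrite ?inE.
  + by rewrite !inE /= /split_adj => /eqP-> /eqP->; rewrite eqxx.
- move=> i; rewrite cardV; apply: leq_delta => [|v].
    by rewrite /= cardT; lia.
  rewrite inE => /eqP vi.
  have clsE : [set w : T | tag w == tag v] = V i by rewrite vi.
  have [vB | vB] := boolP (v \in B).
    have := degree_split_in_B vB; rewrite clsE cardV cardT; lia.
  have [vA | vA] := boolP (v \in A).
    have := degree_split_in_A v; rewrite clsE.
    have /dA : A :&: V i != set0 by apply/set0Pn; exists v; rewrite !inE vA vi /=.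
    lia.
  have := degree_split_notin_A vA; rewrite clsE cardV cardT.
  have := dR _ vA vB; lia.
Qed.

(** Common construction for [f] and [g]: [A] has [t] vertices in the first [i] parts and [B] has
    [t - 1] outside them. A vertex of [A] in part [j] is then adjacent to all of [B], and
    [n_j >= n_i] since sizes do not increase. *)
Lemma realizable_initial (i t d : nat) :
    i <= k -> 0 < t <= psum P i -> t.-1 + psum P i <= n ->
    d <= t + npart P i -> d + t <= n.+1 ->
  realizable d.
Proof.
move=> ik /andP[t0 ts] tn dt dn; pose U := [set u : T | tag u < i].
have cU : #|U| = psum P i := card_initial ik.
have [|A [_ AU cA]] := @subset_between_card _ set0 U t (sub0set _).
  by rewrite cards0 cU.
have [|B [_ BU cB]] := @subset_between_card _ set0 (~: U) t.-1 (sub0set _).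
  by rewrite cards0 cardsCs setCK cU cardT; lia.
have dAB : [disjoint A & B].
  rewrite disjoints_subset; apply: subset_trans AU _.
  by rewrite -setCS setCK in BU *.
apply: (@realizable_split A B) => //; rewrite ?cA ?cB; try lia.
move=> j /set0Pn[u]; rewrite !inE => /andP[uA /eqP uj].
have ji : j < i by have := subsetP AU _ uA; rewrite inE uj.
suff -> : B :&: V j = set0 by rewrite cards0; have := npart_tnth ji ik; lia.
apply/setP => w; rewrite !inE; apply/andP => -[/(subsetP BU)].
by rewrite !inE => /negP wi /eqP wj; apply: wi; rewrite wj.
Qed.

(** * The three terms of Phi *)

Let n2 : 2 <= n := leq_trans hk hn.

(** By minimality of [mu], the index [i] fails its defining inequality, so
    [s_i <= floor((n + 1 - n_i) / 2)]. *)
Let psum_before_mu i : 0 < i < mu P -> (psum P i).*2 + npart P i <= n.+1.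
Proof.
case/andP=> i0 imu; have [/andP[_]] := muP n2 hP; rewrite size_tuple => muk _ minmu.
have := npart_leq_sum i; have := minmu i i0; lia.
Qed.

Lemma realizable_f i : 0 < i < mu P -> realizable (f_ P i).
Proof.
move=> imu; have := psum_before_mu imu.
have [/andP[_]] := muP n2 hP; rewrite size_tuple => muk _ _.
have ik : i <= k by lia.
have : 0 < psum P i.
  case: i imu ik {muk} => // i _ ik; rewrite psumS.
  have := tnth_gt0 (Ordinal ik); rewrite (tnth_nth 0) /npart /=; lia.
rewrite /f_ => ? ?; apply: (@realizable_initial i (psum P i)); lia.
Qed.

Lemma realizable_g : realizable (g P).
Proof.
have [/andP[mu0]] := muP n2 hP; rewrite size_tuple => muk lemu _.
rewrite /g sumP; move: (muk) (mu0) lemu (@psum_before_mu (mu P).-1).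
case: (mu P) => // i ik _; rewrite psumS /= => le1 before.
(* With [i.+1] standing for [mu], this leaves room for [B] outside the first [mu] parts. It follows
   from minimality at [mu - 1] and [n_mu <= n_(mu-1)], or from an empty sum if [mu = 1]. *)
have bound : (psum P i).*2 + npart P i.+1 <= n.+1.
  case: i {le1} ik before => [|i] ik before.
    by rewrite /psum big_geq // add0n leqW.
  have := npart_leq (leqnSn i.+1) ik; have := before (leqnn _); lia.
have mn := npart_leq_sum i.+1.
by apply: (@realizable_initial i.+1 (n - npart P i.+1)./2.+1) => //;
  rewrite ?psumS; lia.
Qed.

Lemma realizable_h : realizable (h P).
Proof.
have [/andP[lam0]] := lambdaP n2 hP; rewrite size_tuple => lamk lelam _.
set l := lambda P in lam0 lamk lelam *.
set c := uphalf n.+1 in lelam.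
pose q := minn (npart P l) (c %/ l).
have hE : h P = uphalf n + q by rewrite /h /h1 /h2 sumP -/l -/c -addn_minr.
pose A0 := [set u : T | (tag u < l) && (tagged u < q)].
pose U := [set u : T | tag u < l].
have qP (j : 'I_k) : j < l -> q <= tnth P j.
  by move=> jl; rewrite (leq_trans (geq_minl _ _)) ?npart_tnth.
have ql : q * l <= c by rewrite -leq_divRL // geq_minr.
have qc : q <= c by apply: leq_trans ql; rewrite leq_pmulr.
have cA0 : #|A0| = l * q.
  rewrite (card_sigma_lt (m := tnth P) (q := fun=> q) (p := fun j : 'I_k => j < l)) //.
  by rewrite -(big_ord_widen k (fun=> q) lamk) sum_nat_const card_ord.
(* [A0] takes the first [q] vertices of each of the first [l] parts; it is enlarged to size [c],
   possible since [l * q <= c <= psum P l]. *)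
have [||A [A0A AU cA]] := @subset_between_card _ A0 U c.
- by apply/subsetP => u; rewrite !inE => /andP[].
- by rewrite cA0 mulnC ql card_initial.
rewrite hE; apply: (@realizable_split A (~: A)).
- by rewrite disjoints_subset setCK.
- by rewrite cardsCs setCK cardT cA /c; lia.
- by move: qc; rewrite /c; lia.
- move=> j /set0Pn[u]; rewrite !inE => /andP[uA /eqP uj].
  have jl : j < l by have := subsetP AU _ uA; rewrite inE uj.
  (* As [#|B| + 1 = n - c + 1 = uphalf n], the degree condition on [A] amounts to this inequality,
     which [A0] guarantees. *)
  have : q <= #|A :&: V j|.
    have <- : #|A0 :&: V j| = q.
      (* [q] becomes a sum over the single index [j], the form that [card_sigma_lt] produces. *)
      rewrite -[RHS](big_pred1_eq addn j (fun=> q)).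
      rewrite -(card_sigma_lt (m := tnth P) (q := fun=> q) (p := pred1 j)).
        apply: eq_card => w; rewrite !inE /= andbAC; congr (_ && _).
        by case: eqP => [->|]; rewrite ?jl ?andbF.
      by move=> i /= /eqP->; apply: qP.
    by rewrite subset_leq_card ?setSI.
  have -> : ~: A :&: V j = V j :\: A by rewrite setDE setIC.
  have := cardsID A (V j); have := cardsC A.
  rewrite cardV cardT cA [V j :&: A]setIC.
  by rewrite /c; lia.
- by move=> u uA; rewrite inE uA.
Qed.

Lemma realizable_Phi : realizable (Phi P).
Proof.
apply: realizable_maxn; last exact: realizable_maxn realizable_g realizable_h.
rewrite /f big_nat; apply: big_ind.
(* The neutral element 0 of the maximum: its degree condition is trivial by truncated subtraction,
   so the graph for [g] serves. *)
- have [F [W [kW cW dW hW]]] := realizable_g; exists F, W.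
  by split=> // i; rewrite !sub0n.
- exact: realizable_maxn.
- exact: realizable_f.
Qed.

End Realization.

Theorem proposition1p4 (n k : nat) (hk : 2 <= k) (hn : k <= n)
    (P : k.-tuple nat) (hP : is_partition n P)
    (hhalf : (npart P 1).*2 <= n) :
  exists (F : sgraph) (V : 'I_k -> {set F}),
    [/\ kpartite V,
        forall i : 'I_k, #|V i| = tnth P i,
        forall i : 'I_k,
          Phi [tuple #|V j| | j < k] - #|V i| - 1 <= delta (V i)
      & ~ hamiltonian F].
Proof.
have [F [V [kV cV dV hV]]] := realizable_Phi hk hn hP; exists F, V; split=> //.
suff -> : [tuple #|V j| | j < k] = P by [].
by apply: eq_from_tnth => j; rewrite tnth_mktuple.
Qed.
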